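(* Let $R$ be a nonzero commutative ring. If $f\in R[[x]]$ is a Z-regular series, then $f$ is the solution of a Z-Mahler equation: there exist $d\ge0$ and polynomials $A_0(x),\dots,A_d(x)\in R[x]$, not all zero, such that $\sum_{i=0}^dA_i(x)\Phi^i(f)=0$, where $\Phi$ is the Z-Mahler operator.
   Context: Zeckendorf numeration: let $F_{-2}=0$, $F_{-1}=1$, $F_n=F_{n-1}+F_{n-2}$ for $n\geq 0$. Every $n\in\mathbb{N}$ has a unique expansion $n=\sum_{i=0}^k b_iF_i$ with $b_i\in\{0,1\}$, no two consecutive digits $1$ and no leading zeros; $(n)_Z=b_k\cdots b_0$. Define $\phi(\sum_i b_iF_i)=\sum_i b_iF_{i+1}$ where $(n)_Z=b_k\cdots b_0$, and $\Phi:R[[x]]\to R[[x]]$, $\Phi(\sum f_nx^n)=\sum f_nx^{\phi(n)}$. Weighted automaton: $\mathcal{A}=(S,B,\Delta,I,F)$ with $S$ a finite set, $I,F:S\to R$ and $\Delta:S\times B\times S\to R$. A path labelled $b_1\cdots b_n$ through $s_0,\dots,s_n$ has weight $I(s_0)\prod_i\Delta(s_{i-1},b_i,s_i)F(s_n)$. $\mathrm{weight}_{\mathcal{A}}(w)$ is the sum of the weights of all paths labelled $w$. A series $f=\sum f_nx^n$ is Z-regular if there is a weighted automaton with $B=\{0,1\}$ such that $f_n=\mathrm{weight}_{\mathcal{A}}((n)_Z)$ for all $n\ge0$, with $(n)_Z$ read from the most significant digit. *)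

(* Defs.v *)
From mathcomp Require Import all_boot all_order all_algebra.
Set Implicit Arguments.
Unset Strict Implicit.
Unset Printing Implicit Defensive.
Import GRing.Theory.

(** * Zeckendorf numeration *)

Fixpoint fib (n : nat) : nat :=
  match n with
  | 0 => 0
  | 1 => 1
  | (m.+1 as n').+1 => fib n' + fib m
  end.

(* The numeration basis F_0 = 1, F_1 = 2, F_2 = 3, ...; the recurrence starts
   from F_(-2) = 0 and F_(-1) = 1, hence the shift by 2. *)
Definition zfib (i : nat) : nat := fib i.+2.

(* Words are written with the most significant digit first, so the digit of
   weight F_i is the i-th letter of [rev w].  [zval j w] is the sum of
   b_i F_(i+j). *)
Definition zval (j : nat) (w : seq bool) : nat :=
  \sum_(i < size w) nth false (rev w) i * zfib (i + j).

Definition no11 (w : seq bool) : bool := sorted (fun a b => ~~ (a && b)) w.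
Arguments no11 : simpl never.

(* [head true w] says that there is no leading zero; the empty word, which
   represents 0, qualifies. *)
Definition zeck_word (w : seq bool) : bool := head true w && no11 w.

Lemma zfibSS i : zfib i.+2 = zfib i.+1 + zfib i.
Proof. by []. Qed.

Lemma zfib_gt0 i : 0 < zfib i.
Proof.
elim/ltn_ind: i => -[|[|i]] IH //.
by rewrite zfibSS ltn_addr // IH.
Qed.

Lemma zfib_leS i : zfib i <= zfib i.+1.
Proof. by case: i => [|i] //; rewrite zfibSS leq_addr. Qed.

Lemma zfib_mono i j : i <= j -> zfib i <= zfib j.
Proof.
move=> /subnK <-; elim: (j - i) => [|k IH]; first by rewrite add0n.
by rewrite addSn (leq_trans IH) // zfib_leS.
Qed.

Lemma zval_nil j : zval j [::] = 0.
Proof. by rewrite /zval big_ord0. Qed.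

Lemma zval_cons j b w : zval j (b :: w) = b * zfib (size w + j) + zval j w.
Proof.
rewrite /zval /= big_ord_recr /= addnC rev_cons nth_rcons size_rev ltnn eqxx.
by congr (_ + _); apply: eq_bigr => i _; rewrite nth_rcons size_rev ltn_ord.
Qed.

Lemma zval_rcons0 w : zval 0 (rcons w false) = zval 1 w.
Proof.
elim: w => [|b w IH]; first by rewrite /= zval_cons !zval_nil.
by rewrite rcons_cons !zval_cons IH size_rcons addn0 addn1.
Qed.

Lemma no11_behead b w : no11 (b :: w) -> no11 w.
Proof. exact: path_sorted. Qed.

Lemma zval_lt w : no11 w -> zval 0 w < zfib (size w).
Proof.
elim: {w}(size w) {-2}w (leqnn (size w)) => [|k IH] [|[] w] //=;
  rewrite ?zval_nil //= ltnS zval_cons addn0 => le_wk.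
  case: w le_wk => [|[] w] //= le_wk; first by rewrite zval_nil.
  move=> /no11_behead; rewrite zval_cons mul0n mul1n zfibSS ltn_add2l.
  by move/no11_behead => ?; apply: IH => //; apply: ltnW.
move=> /no11_behead nw; rewrite mul0n add0n.
by rewrite (leq_trans (IH _ le_wk nw)) // zfib_leS.
Qed.

Lemma zval_inj_size w1 w2 : size w1 = size w2 -> no11 w1 -> no11 w2 ->
  zval 0 w1 = zval 0 w2 -> w1 = w2.
Proof.
elim: w1 w2 => [|b1 w1 IH] [|b2 w2] //= [es] /no11_behead n1 /no11_behead n2.
rewrite !zval_cons !addn0 es => ev.
have l1 := zval_lt n1; have l2 := zval_lt n2; rewrite es in l1.
case: b1 b2 ev => [] []; rewrite ?mul0n ?mul1n ?add0n => ev.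
- by move/addnI: ev => ev; rewrite (IH w2).
- by move: l2; rewrite -ev ltnNge leq_addr.
- by move: l1; rewrite ev ltnNge leq_addr.
- by rewrite (IH w2).
Qed.

Lemma zeck_word_size w1 w2 : zeck_word w1 -> zeck_word w2 ->
  zval 0 w1 = zval 0 w2 -> size w1 <= size w2.
Proof.
case: w1 => [|[] w1] // _ /andP[_ n2]; rewrite zval_cons addn0 mul1n => ev.
rewrite ltnNge; apply/negP => /zfib_mono le21.
have := leq_trans (zval_lt n2) le21.
by rewrite -ev ltnNge leq_addr.
Qed.

Lemma zeck_word_inj w1 w2 : zeck_word w1 -> zeck_word w2 ->
  zval 0 w1 = zval 0 w2 -> w1 = w2.
Proof.
move=> z1 z2 ev; apply: zval_inj_size => //; last 2 first.
- by case/andP: z1.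
- by case/andP: z2.
by apply/eqP; rewrite eqn_leq !zeck_word_size.
Qed.

Lemma no11_exists k n : n < zfib k ->
  exists w, [/\ size w = k, no11 w & zval 0 w = n].
Proof.
elim/ltn_ind: k n => -[|k] IH n lt_n.
  by exists [::]; rewrite zval_nil; case: n lt_n.
case: (ltnP n (zfib k)) => [lt_nk|le_kn].
  have [w [sw nw vw]] := IH k (leqnn _) n lt_nk.
  exists (false :: w); rewrite /= sw zval_cons mul0n; split=> //.
  by case: (w) nw.
case: k IH lt_n le_kn => [|k] IH lt_n le_kn.
  by exists [:: true]; rewrite zval_cons zval_nil; case: n lt_n le_kn => [|[]].
have lt_nk : n - zfib k.+1 < zfib k by rewrite ltn_subLR // -zfibSS.
have [w [sw nw vw]] := IH k (leqnSn _) _ lt_nk.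
exists [:: true, false & w]; rewrite /= sw !zval_cons /= sw addn0 mul0n mul1n.
by rewrite vw add0n subnKC //; split=> //; case: (w) nw.
Qed.

Lemma zeck_exists n : exists w, zeck_word w && (zval 0 w == n).
Proof.
have lt_n : n < zfib n.
  elim: n => [|[|n] IH] //; rewrite zfibSS.
  by rewrite -addn1 leq_add // zfib_gt0.
have [w [_ nw vw]] := no11_exists lt_n.
elim: w nw vw => [|[] w IH] nw vw.
- by exists [::]; rewrite vw eqxx.
- by exists (true :: w); rewrite /zeck_word nw vw eqxx.
- by apply: IH (no11_behead nw) _; rewrite -vw zval_cons.
Qed.

(* The Zeckendorf expansion of n. *)
Definition zeck (n : nat) : seq bool := xchoose (zeck_exists n).

Lemma zeckP n : zeck_word (zeck n).
Proof. by case/andP: (xchooseP (zeck_exists n)). Qed.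

Lemma zval_zeck n : zval 0 (zeck n) = n.
Proof. by case/andP: (xchooseP (zeck_exists n)) => _ /eqP. Qed.

Lemma zeck_unique n w : zeck_word w -> zval 0 w = n -> w = zeck n.
Proof.
by move=> zw vw; apply: zeck_word_inj => //; rewrite ?zeckP // zval_zeck.
Qed.

Definition phi (n : nat) : nat := zval 1 (zeck n).

Lemma leq_phi n : n <= phi n.
Proof.
rewrite -{1}(zval_zeck n) /phi /zval; apply: leq_sum => i _.
by rewrite leq_mul2l addn0 addn1 zfib_leS orbT.
Qed.

Lemma phi_inj : injective phi.
Proof.
move=> m n; rewrite /phi -!zval_rcons0 => ev.
have no11_rcons w : no11 w -> no11 (rcons w false).
  by case: w => // b w; rewrite /no11 /= rcons_path andbF => ->.
have lead0 w : zeck_word w -> w = [::] \/ zeck_word (rcons w false).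
  case: w => [|[] w]; [by left | | by []].
  by case/andP=> _ nw; right; exact: (no11_rcons (true :: w)).
have pos w : zeck_word (rcons w false) -> 0 < zval 0 (rcons w false).
  case: w => [|[] w] // _; rewrite rcons_cons zval_cons mul1n.
  by rewrite ltn_addr // zfib_gt0.
rewrite -(zval_zeck m) -(zval_zeck n); congr (zval 0 _).
case: (lead0 _ (zeckP m)) (lead0 _ (zeckP n)) ev => [->|zm] [->|zn] //=.
- by move=> ev; have := pos _ zn; rewrite -ev zval_cons zval_nil.
- by move=> ev; have := pos _ zm; rewrite ev zval_cons zval_nil.
- by move=> ev; apply: (@rcons_injl _ false); apply: zeck_word_inj.
Qed.

Local Open Scope ring_scope.

(** * Formal power series *)

(* A formal power series is given by its sequence of coefficients. *)
Definition fps (R : Type) : Type := nat -> R.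

Definition poly_fps_mul (R : comNzRingType) (A : {poly R}) (f : fps R) : fps R :=
  fun n => \sum_(i < n.+1) A`_i * f (n - i)%N.

(* The Z-Mahler operator.  The coefficient of x^m is the sum of the f_n with
   phi n = m; the bound n <= m is harmless by [leq_phi], and by [phi_inj] there
   is at most one term. *)
Definition zPhi (R : comNzRingType) (f : fps R) : fps R :=
  fun m => \sum_(n < m.+1 | phi n == m) f n.

Lemma zPhi_phi (R : comNzRingType) (f : fps R) n : zPhi f (phi n) = f n.
Proof.
rewrite /zPhi (bigD1 (Ordinal (leq_phi n : (n < (phi n).+1)%N))) //= big1 ?addr0 //.
move=> i /andP[/eqP/phi_inj e /eqP[]]; exact: val_inj.
Qed.

Lemma zPhi_out (R : comNzRingType) (f : fps R) m :
  (forall n, phi n <> m) -> zPhi f m = 0.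
Proof. by move=> out; rewrite /zPhi big1 // => i /eqP/out. Qed.

(** * Weighted automata *)

Record wautomaton (R : Type) (B : Type) := WAutomaton {
  wa_state : finType;
  wa_trans : wa_state -> B -> wa_state -> R;
  wa_init : wa_state -> R;
  wa_final : wa_state -> R
}.

(* The weight of the path s_0, ..., s_n labelled by w, with n the length of
   w. *)
Definition path_weight (R : comNzRingType) (B : Type) (A : wautomaton R B)
    (w : seq B) (s : {ffun 'I_(size w).+1 -> wa_state A}) : R :=
  wa_init (s ord0)
  * (\prod_(i < size w)
       wa_trans (s (widen_ord (leqnSn _) i)) (tnth (in_tuple w) i)
                (s (lift ord0 i)))
  * wa_final (s ord_max).

Definition weight (R : comNzRingType) (B : Type) (A : wautomaton R B)
    (w : seq B) : R :=
  \sum_(s : {ffun 'I_(size w).+1 -> wa_state A}) path_weight s.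

Definition zregular (R : comNzRingType) (f : fps R) : Prop :=
  exists A : wautomaton R bool, forall n, f n = weight A (zeck n).

(* Main.v *)
(* Split the states of the automaton by the last digit read, so that each
   series V_(s,b) collects the weights of the runs on (n)_Z that end in the
   state s when the last digit of n is b.  Removing the last digit of n
   expresses every Phi^i V_t over R[x] in terms of the Phi^(i+1) V_t': a final
   0 is absorbed by Phi, and a final 1 (necessarily preceded by a 0) contributes
   a factor x^(F_i).  Hence f, Phi f, ..., Phi^N f all lie in the R[x]-module
   spanned by the series Phi^N V_t.  Taking N to be the number of these
   generators, N + 1 vectors in rank N are linearly dependent, over any nonzero
   commutative ring. *)
Require Import Defs.
From mathcomp Require Import all_boot all_order all_algebra.
Set Implicit Arguments.
Unset Strict Implicit.
Unset Printing Implicit Defensive.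
Import GRing.Theory.
Local Open Scope ring_scope.

(* Pad M to a square matrix N with zero last column and let p be monic with
   p(N) = 0, as given by Cayley-Hamilton.  The bottom right entry shows that
   p = 'X q, so that q(N) N = 0: either q(N) has a nonzero row, which is then in
   the kernel, or the degree of p can be lowered. *)
Lemma tall_matrix_left_kernel (R : comNzRingType) (n : nat)
    (M : 'M[R]_(n.+1, n)) :
  exists v : 'rV[R]_n.+1, v != 0 /\ v *m M = 0.
Proof.
pose J : 'M[R]_(n, n.+1) := pid_mx n.
pose K : 'M[R]_(n.+1, n) := pid_mx n.
have JK : J *m K = 1%:M by rewrite mul_pid_mx !minnn (minn_idPr (leqnSn n)) pid_mx_1.
pose N := M *m J.
suff /(_ (char_poly N)) : forall p, p \is monic -> horner_mx N p = 0 ->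
    exists v : 'rV[R]_n.+1, v != 0 /\ v *m M = 0.
  by apply; [exact: char_poly_monic | exact: Cayley_Hamilton].
elim/poly_ind => [|p c IH]; first by rewrite monicE lead_coef0 eq_sym oner_eq0.
move=> mon; rewrite rmorphD rmorphM /= horner_mx_X horner_mx_C => pN0.
have c0 : c = 0.
  have := congr1 (fun B : 'M_n.+1 => B ord_max ord_max) pN0.
  rewrite [_ * N]mulmxA !mxE eqxx mulr1n big1 ?add0r // => i _.
  by rewrite !mxE /= ltn_eqF ?mulr0.
move: mon pN0; rewrite c0 !(raddf0, addr0) monicE lead_coefMX -monicE => mon pN0.
case: (eqVneq (horner_mx N p) 0) => [/IH|nz]; first exact.
have [i rnz] : exists i, row i (horner_mx N p) != 0.
  apply/existsP; rewrite -[X in is_true X]negbK negb_exists.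
  apply: contra nz => /forallP z; apply/eqP/row_matrixP => i.
  by rewrite row0; apply/eqP; rewrite -[_ == _]negbK.
exists (row i (horner_mx N p)); split=> //.
rewrite -[M]mulmx1 -JK -row_mul (mulmxA M J K) -/N mulmxA.
by rewrite [_ *m N]pN0 mul0mx row0.
Qed.

(** * Spans of power series over [{poly R}] *)

Section Span.
Variable R : comNzRingType.
Implicit Types (f g : fps R) (A B : {poly R}).

(** Coefficient [n] of the product only sees the coefficients of [f] up to [n], so truncating [f] to
    a polynomial transfers the ring laws of [{poly R}]. *)
Lemma poly_fps_mulE m A f n : (n < m)%N ->
  poly_fps_mul A f n = (A * \poly_(i < m) f i)`_n.
Proof.
move=> ltnm; rewrite coefM; apply: eq_bigr => i _.
by rewrite coef_poly (leq_ltn_trans (leq_subr _ _) ltnm).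
Qed.

Lemma eq_poly_fps_mul A f g n :
  (forall k, f k = g k) -> poly_fps_mul A f n = poly_fps_mul A g n.
Proof. by move=> efg; apply: eq_bigr => i _; rewrite efg. Qed.

Lemma poly_fps_mulA A B f n :
  poly_fps_mul A (poly_fps_mul B f) n = poly_fps_mul (A * B) f n.
Proof.
rewrite [RHS](@poly_fps_mulE n.+1) // -mulrA coefM; apply: eq_bigr => i _.
by rewrite -poly_fps_mulE // ltnS leq_subr.
Qed.

Lemma poly_fps_mul_suml (I : finType) (A : I -> {poly R}) f n :
  poly_fps_mul (\sum_i A i) f n = \sum_i poly_fps_mul (A i) f n.
Proof.
rewrite exchange_big; apply: eq_bigr => i _.
by rewrite coef_sum mulr_suml.
Qed.

Lemma poly_fps_mul_sumr (I : finType) A (f : I -> fps R) n :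
  poly_fps_mul A (fun k => \sum_i f i k) n = \sum_i poly_fps_mul A (f i) n.
Proof.
by rewrite exchange_big; apply: eq_bigr => i _; rewrite mulr_sumr.
Qed.

Lemma poly_fps_mulC c f n : poly_fps_mul c%:P f n = c * f n.
Proof.
rewrite (@poly_fps_mulE n.+1) // coefCM coef_poly leqnn //.
Qed.

Lemma poly_fps_mul0 f n : poly_fps_mul 0 f n = 0.
Proof. by rewrite poly_fps_mulC mul0r. Qed.

Lemma poly_fps_mulXn j f n :
  poly_fps_mul 'X^j f n = if (j <= n)%N then f (n - j)%N else 0.
Proof.
rewrite (@poly_fps_mulE n.+1) // coefXnM coef_poly ltnS leq_subr ltnNge.
by case: leqP.
Qed.

Definition in_span (T : finType) (e : T -> fps R) (g : fps R) : Prop :=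
  exists q : T -> {poly R}, forall n, g n = \sum_t poly_fps_mul (q t) (e t) n.

Lemma in_span_gen (T : finType) (e : T -> fps R) t : in_span e (e t).
Proof.
exists (fun t' => (t' == t)%:R%:P) => n.
rewrite (bigD1 t) //= eqxx poly_fps_mulC mul1r big1 ?addr0 // => t' /negPf ->.
by rewrite poly_fps_mulC mul0r.
Qed.

Lemma in_span_trans (T T' : finType) (e : T -> fps R) (e' : T' -> fps R) g :
  (forall t, in_span e' (e t)) -> in_span e g -> in_span e' g.
Proof.
move=> /fin_all_exists[Q eQ] [q gq].
exists (fun t' => \sum_t q t * Q t t') => n.
rewrite gq; under [RHS]eq_bigr do rewrite poly_fps_mul_suml.
rewrite [RHS]exchange_big; apply: eq_bigr => t _ /=.
rewrite (eq_poly_fps_mul _ _ (eQ t)) poly_fps_mul_sumr.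
by apply: eq_bigr => t' _; rewrite poly_fps_mulA.
Qed.

Lemma in_span_sum (T I : finType) (e : T -> fps R) (A : I -> {poly R})
    (h : I -> fps R) g :
  (forall i, in_span e (h i)) ->
  (forall n, g n = \sum_i poly_fps_mul (A i) (h i) n) -> in_span e g.
Proof. by move=> eh gh; apply: in_span_trans eh _; exists A. Qed.

Lemma in_span_lin (T I : finType) (e : T -> fps R) (c : I -> R)
    (h : I -> fps R) g :
  (forall i, in_span e (h i)) ->
  (forall n, g n = \sum_i c i * h i n) -> in_span e g.
Proof.
move=> eh gh; apply: (in_span_sum (A := fun i => (c i)%:P) eh) => n.
by rewrite gh; apply: eq_bigr => i _; rewrite poly_fps_mulC.
Qed.

(** The coordinates of the [g i] form a matrix over [{poly R}] with one more row than columns; a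
    nonzero left kernel vector is the relation. *)
Lemma span_dependence (T : finType) (e : T -> fps R) (g : nat -> fps R) :
  (forall i, (i <= #|T|)%N -> in_span e (g i)) ->
  exists A : 'I_#|T|.+1 -> {poly R}, (exists i, A i != 0) /\
    forall n, \sum_(i < #|T|.+1) poly_fps_mul (A i) (g i) n = 0.
Proof.
move=> span_g.
have /fin_all_exists[Q gQ] (i : 'I_#|T|.+1) := span_g i (leq_ord i).
have [v [v0 vQ]] := tall_matrix_left_kernel (\matrix_(i, j) Q i (enum_val j)).
exists (v 0); split.
  apply/existsP; apply: contraR v0; rewrite negb_exists => /forallP z.
  apply/eqP/rowP => i; rewrite [RHS]mxE; apply/eqP; rewrite -[_ == _]negbK.
  exact: z.
move=> n.
under eq_bigr => i _ do
  rewrite (eq_poly_fps_mul _ _ (gQ i)) poly_fps_mul_sumr.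
rewrite exchange_big big1 // => t _ /=.
under eq_bigr => i _ do rewrite poly_fps_mulA.
rewrite -poly_fps_mul_suml.
have := congr1 (fun w : 'rV_ _ => w 0 (enum_rank t)) vQ; rewrite !mxE.
under eq_bigr => i _ do rewrite mxE enum_rankK.
by move=> ->; rewrite poly_fps_mul0.
Qed.

End Span.

(** * Deleting and appending the last Zeckendorf digit *)

Lemma zval_rcons j w b : zval j (rcons w b) = (zval j.+1 w + b * zfib j)%N.
Proof.
elim: w => [|a w IH]; first by rewrite /= zval_cons !zval_nil addnC.
by rewrite rcons_cons !zval_cons IH size_rcons addSnnS addnA.
Qed.

Lemma no11_rcons w b : no11 (rcons w b) = no11 w && ~~ (last false w && b).
Proof. by case: w => // a w; rewrite /no11 /= rcons_path. Qed.

Lemma zeck0 : zeck 0 = [::].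
Proof. by symmetry; apply: zeck_unique; rewrite ?zval_nil. Qed.

Lemma phi0 : phi 0 = 0%N.
Proof. by rewrite /phi zeck0 zval_nil. Qed.

Lemma zeck_phi n : n != 0%N -> zeck (phi n) = rcons (zeck n) false.
Proof.
move=> n0; symmetry; apply: zeck_unique; last exact: zval_rcons0.
have := zeckP n; rewrite /zeck_word no11_rcons andbF andbT.
by case E: (zeck n) n0 => //; rewrite -(zval_zeck n) E zval_nil.
Qed.

Lemma zeck_phiS n : ~~ last false (zeck n) ->
  zeck (phi n).+1 = rcons (zeck n) true.
Proof.
move=> ln; symmetry; apply: zeck_unique.
  have := zeckP n; rewrite /zeck_word no11_rcons andbT ln andbT.
  by case: (zeck n).
by rewrite zval_rcons mul1n addn1.
Qed.

Lemma zeck_cases n :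
  [\/ n = 0%N, exists2 m, m != 0%N & n = phi m
    | exists2 m, ~~ last false (zeck m) & n = (phi m).+1].
Proof.
have := zeckP n; have := zval_zeck n.
case/lastP: (zeck n) => [|w b] <-; first by rewrite zval_nil; constructor 1.
rewrite /zeck_word no11_rcons => /and3P[hw nw lw].
have zw : w != [::] -> zeck_word w.
  by move=> wn; rewrite /zeck_word nw andbT; case: (w) wn hw.
have zwE : zeck_word w -> w = zeck (zval 0 w) by move=> ?; exact: zeck_unique.
rewrite zval_rcons; case: b hw lw => hw lw.
  have {}zwE : w = zeck (zval 0 w).
    by case: (w) zw zwE => [_ _|a v zw]; [rewrite zval_nil zeck0 | apply; exact: zw].
  constructor 3; exists (zval 0 w); rewrite -?zwE; first by rewrite andbT in lw.
  by rewrite /phi -zwE mul1n addn1.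
(* The one-letter word 0 has a leading zero, so something must precede a final 0. *)
have wn : w != [::] by case: (w) hw.
constructor 2; exists (zval 0 w); last by rewrite /phi -zwE ?zw // addn0.
apply: contraNneq wn => w0.
by rewrite (zwE (zw _)) ?w0 ?zeck0 //; case: (w) hw.
Qed.

(** For nonzero [n], appending a 0 yields a Zeckendorf word again, so repeated shifts never need
    renormalizing. *)
Lemma iter_phi i n : iter i phi n = zval i (zeck n).
Proof.
elim: i n => [|i IH] n; first by rewrite zval_zeck.
rewrite iterSr IH; case: (eqVneq n 0%N) => [->|n0].
  by rewrite phi0 zeck0 !zval_nil.
by rewrite zeck_phi // zval_rcons addn0.
Qed.

(** This is the source of the factor x^(F_i): shifting the word of [m] followed by 1 moves the final
    1 to weight F_i. *)
Lemma iter_phi_phiS i m : ~~ last false (zeck m) ->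
  iter i phi (phi m).+1 = (iter i.+1 phi m + zfib i)%N.
Proof.
by move=> lm; rewrite !iter_phi zeck_phiS // zval_rcons mul1n.
Qed.

(** * Iterates of the Z-Mahler operator *)

Section Iterates.
Variable R : comNzRingType.
Implicit Types g : fps R.

Lemma iter_zPhi_phi i g n : iter i (@zPhi R) g (iter i phi n) = g n.
Proof. by elim: i => //= i IH; rewrite zPhi_phi. Qed.

Lemma iter_zPhi_out i g k :
  (forall n, iter i phi n <> k) -> iter i (@zPhi R) g k = 0.
Proof.
elim: i k => [|i IH] k out; first by case: (out k).
rewrite /= /zPhi big1 // => n /eqP phin; apply: IH => m em.
by apply: (out m); rewrite /= em.
Qed.

(** Membership in the image is decidable because [phi] never decreases its argument, so a preimage
    of [k] is at most [k]. *)
Lemma iter_phi_image i k :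
  (exists n, k = iter i phi n) \/ (forall n, iter i phi n <> k).
Proof.
have ge n : (n <= iter i phi n)%N.
  by elim: (i) => //= j IH; exact: leq_trans (leq_phi _).
case: (boolP [exists n : 'I_k.+1, iter i phi n == k]) => [/existsP[n /eqP]|no].
  by left; exists n.
right=> n nk; case/existsP: no.
have ltn : (n < k.+1)%N by rewrite ltnS -nk.
by exists (Ordinal ltn); apply/eqP.
Qed.

(** Linearity holds over constants only, since [phi] is not additive. Relations with polynomial
    coefficients must therefore be proved for each iterate directly, as in [state_fps_true]. *)
Lemma iter_zPhi_lin (I : finType) (c : I -> R) (h : I -> fps R) g i :
  (forall n, g n = \sum_j c j * h j n) ->
  forall k, iter i (@zPhi R) g k = \sum_j c j * iter i (@zPhi R) (h j) k.
Proof.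
move=> gh k; case: (iter_phi_image i k) => [[n ->]|out].
  by rewrite iter_zPhi_phi gh; under [RHS]eq_bigr do rewrite iter_zPhi_phi.
rewrite iter_zPhi_out // big1 // => j _.
by rewrite iter_zPhi_out // mulr0.
Qed.

End Iterates.

(** * Automaton weights as products of transition matrices *)

Section Automaton.
Variables (R : comNzRingType) (A : wautomaton R bool).
Notation S := (wa_state A).

Definition wa_step (v : S -> R) (b : bool) (s : S) : R :=
  \sum_s' v s' * wa_trans s' b s.

Definition wa_run (w : seq bool) : S -> R := foldl wa_step (@wa_init _ _ A) w.

Lemma wa_run_rcons w b s :
  wa_run (rcons w b) s = \sum_s' wa_run w s' * wa_trans s' b s.
Proof. by rewrite /wa_run foldl_rcons. Qed.

End Automaton.
Arguments wa_run {R} A w s.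

Lemma reindex_ffun_cons (R : nmodType) (S : finType) n
    (F : {ffun 'I_n.+1 -> S} -> R) :
  \sum_s F s = \sum_(a : S) \sum_(t : {ffun 'I_n -> S})
    F [ffun i => oapp t a (unlift ord0 i)].
Proof.
rewrite pair_big /= (reindex (fun p : S * {ffun 'I_n -> S} =>
  [ffun i => oapp p.2 p.1 (unlift ord0 i)])) //=.
exists (fun s : {ffun 'I_n.+1 -> S} => (s ord0, [ffun j => s (lift ord0 j)])).
  move=> [a t] _ /=; rewrite ffunE unlift_none; congr (_, _).
  by apply/ffunP => j; rewrite !ffunE liftK.
by move=> s _; apply/ffunP => i; rewrite ffunE; case: unliftP => [j|] -> /=;
  rewrite ?ffunE.
Qed.

Lemma weight_run (R : comNzRingType) (A : wautomaton R bool) w :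
  weight A w = \sum_s wa_run A w s * wa_final s.
Proof.
case: A => S D I F; elim: w I => [|b w IH] I.
  rewrite /weight reindex_ffun_cons; apply: eq_bigr => a _.
  have e (t : {ffun 'I_0 -> S}) : t = [ffun=> a] by apply/ffunP => -[].
  rewrite (bigD1 [ffun=> a]) //= big1 ?addr0; last first.
    by move=> t /eqP[]; exact: e.
  by rewrite /path_weight /= big_ord0 mulr1 !ffunE (ord1 ord_max) !unlift_none.
(* The first letter is absorbed into a new initial vector; this is why the induction generalizes
   over [I]. *)
transitivity (weight (WAutomaton D (@wa_step _ (WAutomaton D I F) I b) F) w);
  last exact: IH.
rewrite /weight reindex_ffun_cons exchange_big; apply: eq_bigr => t _ /=.
rewrite /path_weight /= /wa_step !mulr_suml; apply: eq_bigr => a _.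
rewrite big_ord_recl /= !ffunE unlift_none /=.
rewrite (_ : widen_ord _ _ = ord0); last exact: val_inj.
rewrite unlift_none liftK /= (_ : ord_max = lift ord0 ord_max); last exact: val_inj.
rewrite liftK /= -!mulrA; congr (_ * (_ * (_ * _))).
apply: eq_bigr => i _; rewrite !ffunE.
rewrite (_ : widen_ord _ _ = lift ord0 (widen_ord (leqnSn _) i)); last exact: val_inj.
by rewrite !liftK /= !(tnth_nth b).
Qed.

(** * Removing the last digit from the series split by state and digit *)

Section Descent.
Variables (R : comNzRingType) (A : wautomaton R bool).
Notation S := (wa_state A).

(* Splitting by the last digit [b] records which words may be extended by the
   digit 1; the constant series 1, at [inr tt], absorbs the fact that the empty
   word extended by 0 is not a Zeckendorf word. *)
Definition state_fps (t : S * bool + unit) : fps R := fun n =>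
  match t with
  | inl (s, b) => wa_run A (zeck n) s *+ (last false (zeck n) == b)
  | inr _ => (n == 0%N)%:R
  end.

Lemma state_fps_false s n :
  state_fps (inl (s, false)) n =
  \sum_(t : S * bool + unit)
    (match t with
     | inl p => wa_trans p.1 false s
     | inr _ => wa_init s - \sum_s' wa_init s' * wa_trans s' false s
     end) * zPhi (state_fps t) n.
Proof.
(* A 0 may follow either digit, so summing over the recorded digit restores the full run. *)
have runE m : \sum_(p : S * bool)
    wa_trans p.1 false s * state_fps (inl p) m
  = \sum_s' wa_run A (zeck m) s' * wa_trans s' false s.
  transitivity (\sum_(p : S * bool)
      wa_trans p.1 false s * state_fps (inl (p.1, p.2)) m).
    by apply: eq_bigr => -[].
  rewrite -(pair_bigA _ (fun s' b => wa_trans s' false s * state_fps (inl (s', b)) m)) /=.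
  apply: eq_bigr => s' _.
  by rewrite big_bool /=; case: last; rewrite /= ?mulr0 ?add0r ?addr0 mulrC.
have runPhi m : \sum_(p : S * bool)
    wa_trans p.1 false s * zPhi (state_fps (inl p)) (phi m)
  = \sum_s' wa_run A (zeck m) s' * wa_trans s' false s.
  by rewrite -runE; apply: eq_bigr => p _; rewrite zPhi_phi.
rewrite big_sumType [X in _ = _ + X](big_pred1 tt) /=; last by case.
case: (zeck_cases n) => [->|[m m0 ->]|[m lm ->]].
(* At 0 the first sum describes runs on the one-letter word 0, whereas the expansion of 0 is empty;
   the coefficient at [inr tt] is exactly the difference. *)
- have := runPhi 0%N; have := zPhi_phi (state_fps (inr tt)) 0.
  rewrite phi0 => -> ->; rewrite /= zeck0 /= mulr1n mulr1.
  by rewrite addrC subrK.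
- by rewrite runPhi zPhi_phi zeck_phi //= last_rcons wa_run_rcons (negPf m0) mulr0 addr0.
rewrite zeck_phiS //= last_rcons mulr0n.
(* Values of [phi] never have last digit 1, so both sides vanish here. *)
have out g : zPhi (R := R) g (phi m).+1 = 0.
  apply: zPhi_out => k ek.
  have := congr1 (last false) (congr1 zeck ek).
  rewrite zeck_phiS // last_rcons.
  case: (eqVneq k 0%N) => [->|k0]; first by rewrite phi0 zeck0.
  by rewrite zeck_phi // last_rcons.
by rewrite out mulr0 addr0 big1 // => p _; rewrite out mulr0.
Qed.

(** Only words not ending in 1 extend by 1, hence only the series at [(s', false)] occur;
    [iter_phi_phiS] locates the nonzero coefficients. *)
Lemma state_fps_true i s k :
  iter i (@zPhi R) (state_fps (inl (s, true))) k =
  \sum_s' poly_fps_mul (wa_trans s' true s *: 'X^(zfib i))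
    (iter i.+1 (@zPhi R) (state_fps (inl (s', false)))) k.
Proof.
under eq_bigr => s' _ do
  rewrite -mul_polyC -poly_fps_mulA poly_fps_mulC poly_fps_mulXn.
have phiS_match m : ~~ last false (zeck m) ->
    state_fps (inl (s, true)) (phi m).+1
    = \sum_s' wa_trans s' true s * state_fps (inl (s', false)) m.
  move=> lm; rewrite /= zeck_phiS // last_rcons wa_run_rcons.
  by apply: eq_bigr => s' _; rewrite (negPf lm) mulrC.
have other : (forall m, ~~ last false (zeck m) ->
    k <> (iter i.+1 phi m + zfib i)%N) ->
    iter i (@zPhi R) (state_fps (inl (s, true))) k = 0.
  move=> nk; case: (iter_phi_image i k) => [[n en]|out]; last first.
    exact: iter_zPhi_out.
  rewrite en iter_zPhi_phi; case: (zeck_cases n) en => [-> _|[m m0 -> _]|[m lm ->] en].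
  - by rewrite /= zeck0.
  - by rewrite /= zeck_phi // last_rcons.
  - by case: (nk m lm); rewrite en iter_phi_phiS.
case: leqP => [le_k|lt_k]; last first.
  rewrite other => [|m _ ek]; last by move: lt_k; rewrite ek ltnNge leq_addl.
  by rewrite big1 // => s' _; rewrite mulr0.
case: (iter_phi_image i.+1 (k - zfib i)) => [[m em]|out].
  under eq_bigr => s' _ do rewrite em iter_zPhi_phi.
  have ek : k = (iter i.+1 phi m + zfib i)%N by rewrite -em subnK.
  (* If [m] ends in 1, the right side vanishes by the split, and the left side does too: by
     injectivity of [phi], no other [m'] could produce [k]. *)
  case lm: (last false (zeck m)).
    rewrite other; first by rewrite big1 // => s' _; rewrite /= lm mulr0.
    move=> m' lm' em'; move: lm'.
    suff -> : m' = m by rewrite lm.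
    move: ek; rewrite em' => /addIn; elim: (i.+1) => //= j IH /phi_inj.
    exact: IH.
  by rewrite ek -iter_phi_phiS ?lm // iter_zPhi_phi phiS_match ?lm.
rewrite other => [|m _ ek]; last by apply: (out m); rewrite ek addnK.
by rewrite big1 // => s' _; rewrite iter_zPhi_out ?mulr0.
Qed.

(** The constant series 1 is fixed by the operator because [phi] fixes only 0 among the preimages of
    0; the sum over [unit] fits [in_span_lin]. *)
Lemma state_fps_one n :
  state_fps (inr tt) n =
  \sum_(t : unit) 1 * zPhi (state_fps (inr t)) n.
Proof.
rewrite (big_pred1 tt) ?mul1r => [|[]] //.
case: (eqVneq n 0%N) => [->|n0].
  by have := zPhi_phi (state_fps (inr tt)) 0; rewrite phi0.
rewrite /= (negPf n0) /zPhi big1 // => m /eqP em.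
by rewrite /=; case: (eqVneq (nat_of_ord m) 0%N) => // m0; rewrite -em m0 phi0 in n0.
Qed.

Lemma iter_state_fps_descent i t :
  in_span (fun t' => iter i.+1 (@zPhi R) (state_fps t'))
    (iter i (@zPhi R) (state_fps t)).
Proof.
have gen t' : in_span (fun t' => iter i.+1 (@zPhi R) (state_fps t'))
    (iter i (@zPhi R) (zPhi (state_fps t'))).
  by rewrite -iterSr; exact: (in_span_gen (fun t' => iter i.+1 _ (state_fps t'))).
case: t => [[s []]|[]].
- apply: in_span_sum (state_fps_true i s) => s'.
  exact: (in_span_gen (fun t' => iter i.+1 _ (state_fps t'))).
- exact: in_span_lin gen (iter_zPhi_lin i (state_fps_false s)).
- exact: in_span_lin (fun t => gen (inr t)) (iter_zPhi_lin i state_fps_one).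
Qed.

Lemma iter_state_fps_span N i t : (i <= N)%N ->
  in_span (fun t' => iter N (@zPhi R) (state_fps t'))
    (iter i (@zPhi R) (state_fps t)).
Proof.
elim: N => [|N IH]; first by rewrite leqn0 => /eqP ->; exact: in_span_gen.
rewrite leq_eqVlt => /orP[/eqP ->|/IH].
  exact: (in_span_gen (fun t' => iter N.+1 _ (state_fps t'))).
exact: in_span_trans (iter_state_fps_descent N).
Qed.

Lemma weight_state_fps n :
  weight A (zeck n) = \sum_(p : S * bool) wa_final p.1 * state_fps (inl p) n.
Proof.
transitivity (\sum_(p : S * bool) wa_final p.1 * state_fps (inl (p.1, p.2)) n);
  last by apply: eq_bigr => -[].
rewrite weight_run.
rewrite -(pair_bigA _ (fun s b => wa_final s * state_fps (inl (s, b)) n)) /=.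
apply: eq_bigr => s _.
by rewrite big_bool /=; case: last; rewrite /= ?mulr0 ?add0r ?addr0 mulrC.
Qed.

End Descent.

Theorem corollary34 (R : comNzRingType) (f : fps R) (hf : zregular f) :
  exists (d : nat) (A : 'I_d.+1 -> {poly R}),
    (exists i, A i != 0) /\
    (forall n : nat,
       \sum_(i < d.+1) poly_fps_mul (A i) (iter i (@zPhi R) f) n = 0).
Proof.
case: hf => A fA; set N := #|{: wa_state A * bool + unit}|; exists N.
apply: (span_dependence (e := fun t => iter N (@zPhi R) (state_fps t))) => i le_iN.
(* The coefficients are constants, so this relation passes to every iterate. *)
have f_lin n : f n = \sum_(p : wa_state A * bool)
    wa_final p.1 * state_fps (inl p) n by rewrite fA weight_state_fps.
apply: in_span_lin (iter_zPhi_lin i f_lin) => p.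
exact: (iter_state_fps_span (inl p) le_iN).
Qed.
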